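(* Let $\mathfrak{g}$ be a simple Lie algebra of rank $n$ over a field $\Bbbk$, namely the Lie algebra of a simply-connected Chevalley group $G$ over $\Bbbk$, and let $\alpha_1,\dots,\alpha_D$ be its positive roots. Then there is an inclusion of ideals $$I_{\Delta(\mathfrak{g})}\ \subseteq\ \mathcal{I}_{\mathcal{B}}\ \subset\ \Bbbk[\mathbf{x}] = \Bbbk[x_1,\dots,x_D].$$
   Context: Setting: $G$ is the simply-connected Chevalley group over $\Bbbk$ of a reduced irreducible root system, with split maximal torus $\mathbb{T}$ and opposite Borel subgroups $B,B^-$ with $B\cap B^-=\mathbb{T}$; $\mathbb{U}=R_u(B)$, $\mathbb{L}=R_u(B^-)$. Let $R^+=\{\alpha_1,\dots,\alpha_D\}$ be the positive roots and $\mathfrak{g}=\mathfrak{l}\oplus\mathfrak{h}\oplus\mathfrak{u}$ with $\mathfrak{h}=\mathrm{Lie}(\mathbb{T})$, $\mathfrak{u}=\mathrm{Lie}(\mathbb{U})=\bigoplus_{\alpha\in R^+}\mathfrak{g}_\alpha$, $\mathfrak{l}=\mathrm{Lie}(\mathbb{L})=\bigoplus_{\alpha\in R^+}\mathfrak{g}_{-\alpha}$. Fix root vectors $X_\alpha\in\mathfrak{g}_\alpha$, $Y_\alpha\in\mathfrak{g}_{-\alpha}$ and $H_\alpha\in\mathfrak{h}$ such that $\langle X_\alpha,Y_\alpha,H_\alpha\rangle\cong\mathfrak{sl}_2$, for $\alpha\in R^+$. The ideal $\mathcal{I}_{\mathcal{B}}$: for finite-dimensional $\Bbbk$-vector spaces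 $V,W$ let $\underline{\mathsf{Hom}}(V,W)$ be the affine space whose $R$-points are the $R$-linear maps $V_R\to W_R$. Let $\varphi\colon\mathbb{U}\to\underline{\mathsf{Hom}}(\mathfrak{l},\mathfrak{h})$ be given by $\varphi_u(C)=\mathrm{proj}_{\mathfrak{h}}(\mathrm{Ad}_u(C))$, where $\mathrm{proj}_{\mathfrak{h}}\colon\mathfrak{g}=\mathfrak{l}\oplus\mathfrak{h}\oplus\mathfrak{u}\to\mathfrak{h}$ is the projection. Let $D_{\mathfrak{l},\mathfrak{h}}\subset\underline{\mathsf{Hom}}(\mathfrak{l},\mathfrak{h})$ be the determinantal subscheme of maps not of maximal rank, i.e. defined by the vanishing of all $n\times n$ minors ($n=\dim\mathfrak{h}$), and $\mathcal{B}=\varphi^{-1}(D_{\mathfrak{l},\mathfrak{h}})\subset\mathbb{U}$. Let $\lambda_\alpha\colon\mathbb{G}_a\to G$ be the root subgroup of $\alpha$ with differential sending the standard generator to $X_\alpha$, and let $\Psi\colon\mathbb{A}^D\xrightarrow{\cong}\mathbb{U}$ be $\Psi(x_1,\dots,x_D)=\lambda_{\alpha_1}(x_1)\cdots\lambda_{\alpha_D}(x_D)$. Then $\mathcal{I}_{\mathcal{B}}\subset\Bbbk[x_1,\dots,x_D]$ is the ideal of the closed subscheme $\Psi^{-1}(\mathcal{B})\subset\mathbb{A}^D$; equivalently, it is generated by the $n\times n$ minors of the $D\times n$ matrix over $\Bbbk[\mathbf{x}]$ of $\varphi_{\Psi(\mathbf{x})}$ with respect to the basis $(Y_{\alpha_i})$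 of $\mathfrak{l}$ and any basis of $\mathfrak{h}$. The ideal $I_{\Delta(\mathfrak{g})}$: view the positive roots as linear functionals on the real vector space $\mathfrak{h}_{\mathbb{R}}$ of dimension $n$, and put $\Omega_{\alpha}=\{H\in\mathfrak{h}_{\mathbb{R}}\mid\langle H,\alpha\rangle=0\}$, $\mathscr{A}(\mathfrak{g})=\{\Omega_\alpha\mid\alpha\in R^+\}$. Let $L(\mathscr{A}(\mathfrak{g}))$ be the lattice of all intersections of members of $\mathscr{A}(\mathfrak{g})$ (including the empty intersection $\mathfrak{h}_{\mathbb{R}}$), ordered by reverse inclusion, and let $L^\circ$ be this lattice with its minimal element $\mathfrak{h}_{\mathbb{R}}$ and its maximal element $\bigcap_{\alpha}\Omega_\alpha$ removed. The nerve complex $\Delta(\mathfrak{g})$ is the simplicial complex on the vertex set $\mathscr{A}(\mathfrak{g})$ whose faces are the subsets of the sets $F_\pi=\{\Omega\in\mathscr{A}(\mathfrak{g})\mid\Omega\supseteq\pi\}$, $\pi\in L^\circ$ (together with the empty face). The Stanley-Reisner ideal $I_{\Delta(\mathfrak{g})}\subset\Bbbk[x_1,\dots,x_D]$ is generated by the monomials $x_{r_1}\cdots x_{r_k}$ (distinct indices) such that $\{\Omega_{\alpha_{r_1}},\dots,\Omega_{\alpha_{r_k}}\}$ is not a face of $\Delta(\mathfrak{g})$.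
   Formalization: The characteristic of the field is assumed to be 0 or a good prime for the root system; the inclusion fails in bad characteristic, e.g. for G2 in characteristic 2, where a product of two variables for orthogonal positive roots lies in the Stanley-Reisner ideal but not in the ideal of B. *)

(* Defs.v *)
From HB Require Import structures.
From mathcomp Require Import all_boot all_order all_algebra.
From mathcomp Require Import reals mpoly.

Set Implicit Arguments.
Unset Strict Implicit.
Unset Printing Implicit Defensive.

Import Order.TTheory GRing.Theory Num.Theory.
Local Open Scope ring_scope.

(* The pairing of the weight lattice Z^n with the coweight lattice Z^n, in dual
   bases. *)
Definition pairing n (x y : 'rV[int]_n) : int := \sum_(j < n) x 0 j * y 0 j.

(* A positive root is an index i : 'I_D; an arbitrary root is a signed index,
   (false, i) standing for alpha_i and (true, i) for - alpha_i. *)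
Definition signed n D (v : 'I_D -> 'rV[int]_n) (s : bool * 'I_D) : 'rV[int]_n :=
  if s.1 then - v s.2 else v s.2.

(* The root datum of a simply connected group with reduced irreducible root
   system, together with an enumeration (in arbitrary order) of the positive
   roots and of their coroots. Roots live in the character lattice Z^n of the
   maximal torus, coroots in its cocharacter lattice Z^n. A positive system is
   the set of roots on which some regular coweight is positive. *)
Record sc_root_datum (n D : nat) := ScRootDatum {
  proot : 'I_D -> 'rV[int]_n;
  pcoroot : 'I_D -> 'rV[int]_n;
  root := signed proot;
  coroot := signed pcoroot;
  root_inj : injective root;
  root_coroot2 : forall i, pairing (proot i) (pcoroot i) = 2;
  root_reflection : forall i s, exists t,
    root t = root s - pairing (root s) (pcoroot i) *: proot i /\
    coroot t = coroot s - pairing (proot i) (coroot s) *: pcoroot i;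
  root_reduced : forall s t, root t <> 2 *: root s;
  root_positive : exists y : 'rV[int]_n, forall i, 0 < pairing (proot i) y;
  root_nonempty : (0 < D)%N;
  root_irreducible : forall P : {set 'I_D}, P != set0 ->
    (forall i j, i \in P -> j \notin P ->
       pairing (proot i) (pcoroot j) = 0) -> P = setT;
  (* simple connectedness: the coroots span the cocharacter lattice *)
  coroot_span : forall y : 'rV[int]_n,
    exists c : 'I_D -> int, y = \sum_(i < D) c i *: pcoroot i }.

Definition neg_index D (s : bool * 'I_D) : bool * 'I_D := (~~ s.1, s.2).

Section RootSublattices.

Context {n D : nat} (Phi : sc_root_datum n D).

Definition is_root (x : 'rV[int]_n) : Prop := exists s, x = root Phi s.

Definition closed_subsystem (P : {set bool * 'I_D}) : Prop :=
  (forall s, s \in P -> neg_index s \in P) /\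
  (forall s t u, s \in P -> t \in P ->
     root Phi u = root Phi s + root Phi t -> u \in P).

Definition root_span (P : {set bool * 'I_D}) (x : 'rV[int]_n) : Prop :=
  exists c : bool * 'I_D -> int, x = \sum_(s in P) c s *: root Phi s.

(* Springer and Steinberg's definition: p is good for R when ZR / ZR' has no
   p-torsion for every closed subsystem R' of R. *)
Definition good_prime (p : nat) : Prop :=
  forall P, closed_subsystem P ->
  forall x, root_span setT x -> root_span P (p%:Z *: x) -> root_span P x.

Definition good_characteristic (k : fieldType) : Prop :=
  forall p, p \in [pchar k] -> good_prime p.

End RootSublattices.

Definition commutator m (X Y : 'M[int]_m) : 'M[int]_m := X *m Y - Y *m X.

(* The element y of the cocharacter lattice acting on a lattice having a basis
   of weight vectors of weights wt. *)
Definition toral n m (wt : 'I_m -> 'rV[int]_n) (y : 'rV[int]_n) : 'M[int]_m :=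
  diag_mx (\row_j pairing (wt j) y).

(* The input of Chevalley's construction: an integral form Z^m, with a basis of
   weight vectors, of a finite-dimensional representation of the split simple
   Lie algebra, given by the matrices of a Chevalley basis. The integral form
   is stable under divided powers, and the weights generate the whole weight
   lattice, so that the resulting group of m x m matrices is the simply
   connected one. Its Lie algebra is then the base change of the Z-span of the
   matrices [chev s] and [toral wt y]. *)
Record sc_chevalley_rep n D (Phi : sc_root_datum n D) (m : nat) :=
  ScChevalleyRep {
  wt : 'I_m -> 'rV[int]_n;
  chev : bool * 'I_D -> 'M[int]_m;
  chev_toral : forall y s,
    commutator (toral wt y) (chev s) = pairing (root Phi s) y *: chev s;
  chev_opp : forall i,
    commutator (chev (false, i)) (chev (true, i)) = toral wt (pcoroot Phi i);
  (* the structure constants are +-(r+1), where r is the greatest integer such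
     that beta - r alpha is a root *)
  chev_add : forall s t u (r : nat), root Phi u = root Phi s + root Phi t ->
    is_root Phi (root Phi t - r%:Z *: root Phi s) ->
    (forall q : nat, is_root Phi (root Phi t - q%:Z *: root Phi s) ->
       (q <= r)%N) ->
    commutator (chev s) (chev t) = r.+1%:Z *: chev u \/
    commutator (chev s) (chev t) = - (r.+1%:Z *: chev u);
  chev_comm : forall s t, root Phi s + root Phi t <> 0 ->
    ~ is_root Phi (root Phi s + root Phi t) ->
    commutator (chev s) (chev t) = 0;
  chev_divided : forall s (r : nat) i j, ((r`!)%:Z %| (chev s ^+ r) i j)%Z;
  wt_span : forall x : 'rV[int]_n,
    exists c : 'I_m -> int, x = \sum_(j < m) c j *: wt j }.

Section ChevalleyGroup.

Context {n D : nat} {Phi : sc_root_datum n D} {m : nat}.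
Variables (V : sc_chevalley_rep Phi m) (k : fieldType).

(* The choice of root vectors over k: X_i and Y_i are arbitrary generators of
   the root spaces of alpha_i and - alpha_i whose bracket is the coroot. *)
Variable c : 'I_D -> k.

Definition X_vec (i : 'I_D) : 'M[k]_m :=
  c i *: map_mx intr (chev V (false, i)).
Definition Y_vec (i : 'I_D) : 'M[k]_m :=
  (c i)^-1 *: map_mx intr (chev V (true, i)).
Definition H_vec (j : 'I_n) : 'M[k]_m :=
  map_mx intr (toral (wt V) (delta_mx 0 j)).

(* u, h and l as row spaces inside gl_m(k), matrices being flattened by
   mxvec. *)
Definition u_mx : 'M[k]_(D, m * m) := \matrix_i mxvec (X_vec i).
Definition h_mx : 'M[k]_(n, m * m) := \matrix_j mxvec (H_vec j).
Definition l_mx : 'M[k]_(D, m * m) := \matrix_i mxvec (Y_vec i).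

Section Points.

Variable A : comUnitAlgType k.

(* The division by r! is exact, by [chev_divided]. *)
Definition divided_power (s : bool * 'I_D) (r : nat) : 'M[int]_m :=
  map_mx (fun z => (z %/ (r`!)%:Z)%Z) (chev V s ^+ r).

(* The root subgroup of alpha_i, exp (t X_i); the powers of X_i vanish from the
   m-th on. *)
Definition lambda (i : 'I_D) (t : A) : 'M[A]_m :=
  \sum_(r < m.+1)
    (c i *: t) ^+ r *: map_mx intr (divided_power (false, i) r).

Definition Psi (x : 'I_D -> A) : 'M[A]_m := \prod_(i < D) lambda i (x i).

Definition Ad (u C : 'M[A]_m) : 'M[A]_m := u *m C *m invmx u.

(* The projection of g = l + h + u onto h, extended to A. It is only meaningful
   on the A-points of g. *)
Definition proj_h (C : 'M[A]_m) : 'M[A]_m :=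
  vec_mx (mxvec C *m
    map_mx (GRing.in_alg A) (proj_mx <<h_mx>>%MS (l_mx + u_mx)%MS)).

Definition phi (u C : 'M[A]_m) : 'M[A]_m := proj_h (Ad u C).

(* Coordinates on the A-points of h in the basis H_vec. *)
Definition h_coord (C : 'M[A]_m) : 'rV[A]_n :=
  mxvec C *m map_mx (GRing.in_alg A) (pinvmx h_mx).

(* The matrix of phi_u : l -> h in the bases Y_vec and H_vec. *)
Definition phi_mx (u : 'M[A]_m) : 'M[A]_(D, n) :=
  \matrix_i h_coord (phi u (map_mx (GRing.in_alg A) (Y_vec i))).

End Points.

End ChevalleyGroup.

Definition ideal_gen (A : comPzRingType) (G : A -> Prop) (f : A) : Prop :=
  exists2 s : seq (A * A),
    (forall x, x \in s -> G x.2) & f = \sum_(x <- s) x.1 * x.2.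

(* The ideal of the closed subscheme of the affine space pulled back from the
   determinantal subscheme of Hom(l, h): the maximal minors of phi at the
   universal point of the affine space. *)
Definition ideal_B n D (Phi : sc_root_datum n D) m (V : sc_chevalley_rep Phi m)
    (k : fieldType) (c : 'I_D -> k) : {mpoly k[D]} -> Prop :=
  ideal_gen (fun g => exists2 f : 'I_n -> 'I_D, injective f &
    g = \det (rowsub f
          (phi_mx V c (Psi V c (fun i => 'X_i : {mpoly k[D]}))))).

Section NerveComplex.

Context {n D : nat} (Phi : sc_root_datum n D) (R : realType).

(* h_R is the real span R^n of the cocharacter lattice. *)
Definition Omega (i : 'I_D) : {vspace 'rV[R]_n} :=
  lker (linfun (mulmxr (map_mx intr (proot Phi i))^T)).

Definition in_lattice (W : {vspace 'rV[R]_n}) : Prop :=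
  exists S : {set 'I_D}, W = (\bigcap_(i in S) Omega i)%VS.

Definition in_open_lattice (W : {vspace 'rV[R]_n}) : Prop :=
  [/\ in_lattice W, W <> fullv & W <> (\bigcap_(i < D) Omega i)%VS].

(* The hyperplanes Omega i are pairwise distinct, so that sets of vertices of
   the nerve complex are sets of indices. *)
Definition nerve_face (S : {set 'I_D}) : Prop :=
  S = set0 \/
  exists2 W, in_open_lattice W & forall i, i \in S -> (W <= Omega i)%VS.

Definition stanley_reisner_ideal (k : fieldType) : {mpoly k[D]} -> Prop :=
  ideal_gen (fun g => exists2 S : {set 'I_D}, ~ nerve_face S &
    g = \prod_(i in S) ('X_i : {mpoly k[D]})).

End NerveComplex.

(* Main.v *)
Require Import Defs.
From HB Require Import structures.
From mathcomp Require Import all_boot all_order all_algebra.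
From mathcomp Require Import perm boolp reals mpoly.
From mathcomp Require Import ring zify.

Set Implicit Arguments.
Unset Strict Implicit.
Unset Printing Implicit Defensive.

Import Order.TTheory GRing.Theory Num.Theory.
Local Open Scope ring_scope.

(** Write [M] for the matrix of [phi] at the universal point.  The theorem holds
    because [M = T diag(x) C], where [C] is the matrix of the coroots and [T] is
    unitriangular once the positive roots are sorted by height
    ([phi_mx_row]).  Indeed [Ad_u Y_l] is computed by applying successively the
    operators [Ad (exp (x_j e_j)) = \sum_r x_j^r (ad e_j)^r / r!]; each of them
    raises heights, and by reducedness of the root system its only contribution
    of weight zero on the root vectors is [x_j] times the coroot of [alpha_j],
    coming from [Y_j] ([Ad_chev], [Ad_prod_root_subgroup]).

    Since [T] is invertible, every row [x_j alpha_j^vee] of [diag(x) C] is a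
    combination of the rows of [M] ([coroot_row_span]).  By multilinearity, for
    roots [alpha_(f 1), ..., alpha_(f n)] the ideal of maximal minors of [M]
    contains [x_(f 1) ... x_(f n)] times the determinant of the corresponding
    coroots.

    A set of hyperplanes that is not a face of the nerve complex intersects in
    the origin, so the corresponding roots contain [n] linearly independent ones
    ([nonface_basis]), and it remains to see that the determinant of their
    coroots does not vanish in good characteristic [p] ([det_coroots_neq0]).
    With respect to a Weyl-invariant form, a coroot is the root multiplied by
    [2 / (alpha, alpha)], so relations modulo [p] between coroots and between
    roots correspond to each other provided that all squared lengths have the
    same [p]-adic valuation.  They do, because the roots whose squared length is
    divisible by a given power of [p] form a closed subsystem, to which goodness
    applies ([dvd_form_all]).  Relations modulo [p] between independent roots
    are excluded by goodness for the closed subsystem of the roots in their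
    integral span. *)

(** * The pairing of weights and coweights *)

Section Pairing.

Variable n : nat.
Implicit Types x y z : 'rV[int]_n.

Lemma pairingC x y : pairing x y = pairing y x.
Proof. by apply: eq_bigr => j _; rewrite mulrC. Qed.

Lemma pairingDl x y z : pairing (x + y) z = pairing x z + pairing y z.
Proof. by rewrite -big_split; apply: eq_bigr => j _; rewrite mxE mulrDl. Qed.

Lemma pairingZl a x y : pairing (a *: x) y = a * pairing x y.
Proof. by rewrite mulr_sumr; apply: eq_bigr => j _; rewrite mxE mulrA. Qed.

Lemma pairingNl x y : pairing (- x) y = - pairing x y.
Proof. by rewrite -scaleN1r pairingZl mulN1r. Qed.

Lemma pairingBl x y z : pairing (x - y) z = pairing x z - pairing y z.
Proof. by rewrite pairingDl pairingNl. Qed.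

Lemma pairing0l x : pairing 0 x = 0.
Proof. by rewrite -(scale0r 0) pairingZl mul0r. Qed.

Lemma pairing_suml (I : Type) (r : seq I) P (F : I -> 'rV[int]_n) y :
  pairing (\sum_(i <- r | P i) F i) y = \sum_(i <- r | P i) pairing (F i) y.
Proof. exact: (big_morph _ (fun u v => pairingDl u v y) (pairing0l y)). Qed.

Lemma pairingZr a x y : pairing x (a *: y) = a * pairing x y.
Proof. by rewrite !(pairingC x) pairingZl. Qed.

Lemma pairingNr x y : pairing x (- y) = - pairing x y.
Proof. by rewrite !(pairingC x) pairingNl. Qed.

Lemma pairingBr x y z : pairing x (y - z) = pairing x y - pairing x z.
Proof. by rewrite !(pairingC x) pairingBl. Qed.

Lemma pairing_sumr (I : Type) (r : seq I) P (F : I -> 'rV[int]_n) x :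
  pairing x (\sum_(i <- r | P i) F i) = \sum_(i <- r | P i) pairing x (F i).
Proof.
by rewrite pairingC pairing_suml; apply: eq_bigr => i _; rewrite pairingC.
Qed.

Lemma pairing_delta x j : pairing x (delta_mx 0 j) = x 0 j.
Proof.
rewrite /pairing (bigD1 j) //= mxE !eqxx mulr1 big1 ?addr0 // => i ij.
by rewrite mxE (negPf ij) mulr0.
Qed.

Lemma pairing_eq x y : (forall z, pairing x z = pairing y z) -> x = y.
Proof. by move=> e; apply/rowP => j; rewrite -!pairing_delta. Qed.

End Pairing.

(** * Squared root lengths and independence of coroots *)

Section RootDatum.

Variables (n D : nat) (Phi : sc_root_datum n D).
Local Notation rt := (Defs.root Phi).
Local Notation crt := (coroot Phi).
Local Notation al := (proot Phi).
Local Notation cal := (pcoroot Phi).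
Implicit Types (s t : bool * 'I_D).

Lemma root_neg s : rt (neg_index s) = - rt s.
Proof. by case: s => [[] i]; rewrite /Defs.root /signed //= opprK. Qed.

Lemma pairing_root_coroot s : pairing (rt s) (crt s) = 2.
Proof.
case: s => [[] i]; rewrite /Defs.root /coroot /signed /=.
  by rewrite pairingNl pairingNr opprK root_coroot2.
exact: root_coroot2.
Qed.

Lemma root_neq0 s : rt s <> 0.
Proof. by move=> e; have := pairing_root_coroot s; rewrite e pairing0l. Qed.

(** Pairing a root [- (a + 1) rt s] with its own coroot shows that [a + 1]
    divides [2]; the value [2] is excluded because the root system is
    reduced. *)
Lemma root_multiple_neg s t (a : nat) : rt t = - (a.+1%:Z *: rt s) -> a = 0%N.
Proof.
move=> e; have := pairing_root_coroot t; rewrite e pairingNl pairingZl.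
case: a e => [//|[|a]] e h.
  case: (@root_reduced _ _ Phi (neg_index s) t).
  by rewrite e -/(Defs.root Phi _) root_neg scalerN.
have : (a.+3%:Z %| 2%:Z)%Z by rewrite -[2%:Z]h -mulNr dvdz_mulr ?dvdzE ?abszN.
by rewrite dvdzE /= => /dvdn_leq; rewrite !ltnS => /(_ isT).
Qed.

Definition refl_vec i (x : 'rV[int]_n) := x - pairing x (cal i) *: al i.

Lemma refl_vecK i : involutive (refl_vec i).
Proof.
move=> x; rewrite /refl_vec pairingBl pairingZl root_coroot2.
rewrite -addrA -opprD -scalerDl; set a := pairing _ _.
by rewrite (_ : a + (a - a * 2) = 0) ?scale0r ?subr0 //; ring.
Qed.

Definition refl_index i s : bool * 'I_D :=
  odflt s [pick t | (rt t == refl_vec i (rt s)) &&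
                    (crt t == crt s - pairing (al i) (crt s) *: cal i)].

Lemma refl_indexP i s : rt (refl_index i s) = refl_vec i (rt s) /\
  crt (refl_index i s) = crt s - pairing (al i) (crt s) *: cal i.
Proof.
rewrite /refl_index; case: pickP => [t /andP[/eqP-> /eqP->] //|no].
have [t [e1 e2]] := root_reflection Phi i s.
by have := no t; rewrite e1 e2 !eqxx.
Qed.

Lemma refl_index_inj i : injective (refl_index i).
Proof.
move=> s t e; apply: (@root_inj _ _ Phi); apply: (inv_inj (refl_vecK i)).
by rewrite -!(refl_indexP i _).1 e.
Qed.

(** The canonical Weyl-invariant form: it turns coroots into multiples of
    roots. *)
Definition form (x y : 'rV[int]_n) : int :=
  \sum_s pairing x (crt s) * pairing y (crt s).

Lemma formC x y : form x y = form y x.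
Proof. by apply: eq_bigr => s _; rewrite mulrC. Qed.

Lemma formDl x y z : form (x + y) z = form x z + form y z.
Proof.
by rewrite -big_split; apply: eq_bigr => s _; rewrite pairingDl mulrDl.
Qed.

Lemma formZl a x y : form (a *: x) y = a * form x y.
Proof.
by rewrite mulr_sumr; apply: eq_bigr => s _; rewrite pairingZl mulrA.
Qed.

Lemma form0l y : form 0 y = 0.
Proof. by rewrite -(scale0r 0) formZl mul0r. Qed.

Lemma form_suml (I : Type) (r : seq I) P (F : I -> 'rV[int]_n) y :
  form (\sum_(i <- r | P i) F i) y = \sum_(i <- r | P i) form (F i) y.
Proof. exact: (big_morph _ (fun u v => formDl u v y) (form0l y)). Qed.

Lemma formDr x y z : form x (y + z) = form x y + form x z.
Proof. by rewrite !(formC x) formDl. Qed.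

Lemma formZr a x y : form x (a *: y) = a * form x y.
Proof. by rewrite !(formC x) formZl. Qed.

Lemma form_sumr (I : Type) (r : seq I) P (F : I -> 'rV[int]_n) x :
  form x (\sum_(i <- r | P i) F i) = \sum_(i <- r | P i) form x (F i).
Proof. by rewrite formC form_suml; apply: eq_bigr => i _; rewrite formC. Qed.

Lemma form_refl i x y : form (refl_vec i x) (refl_vec i y) = form x y.
Proof.
rewrite [RHS](reindex_inj (@refl_index_inj i)) /=; apply: eq_bigr => s _.
by rewrite (refl_indexP i s).2 !pairingBr !pairingZr /refl_vec !pairingBl
  !pairingZl ![_ * pairing (al i) _]mulrC.
Qed.

Lemma refl_root i : refl_vec i (al i) = - al i.
Proof.
by rewrite /refl_vec root_coroot2 -{1}[al i]scale1r -scalerBl scaleN1r.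
Qed.

Lemma form_proot i x :
  form (al i) (al i) * pairing x (cal i) = 2 * form x (al i).
Proof.
have := form_refl i x (al i); rewrite refl_root -scaleN1r formZr /refl_vec.
rewrite formDl -scaleN1r !formZl; set a := form _ _; set b := form _ _.
by set d := pairing _ _ => h; lia.
Qed.

Lemma form_root s x :
  form (rt s) (rt s) * pairing x (crt s) = 2 * form x (rt s).
Proof.
case: s => [[] i]; rewrite /Defs.root /coroot /signed /=;
  last exact: form_proot.
rewrite -[- al i]scaleN1r !(formZr, formZl) pairingNr.
by have := form_proot i x; lia.
Qed.

Lemma coroot_pairing_eq0 x : (forall i, pairing x (cal i) = 0) -> x = 0.
Proof.
move=> h; apply: pairing_eq => z; rewrite pairing0l.
have [d ->] := coroot_span Phi z.
by rewrite pairing_sumr big1 // => i _; rewrite pairingZr h mulr0.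
Qed.

Lemma form_eq0 x : form x x = 0 -> x = 0.
Proof.
move/eqP; rewrite psumr_eq0 => [/allP h|s _]; last by rewrite -expr2 sqr_ge0.
apply: coroot_pairing_eq0 => i; apply/eqP.
have := h (false, i) (mem_index_enum _).
by rewrite /= mulf_eq0 orbb.
Qed.

Lemma form_nondeg x : (forall y, form y x = 0) -> x = 0.
Proof. by move=> h; apply/form_eq0/h. Qed.

Lemma form_root_gt0 s : 0 < form (rt s) (rt s).
Proof.
rewrite lt_def sumr_ge0 ?andbT => [|t _]; last by rewrite -expr2 sqr_ge0.
by apply/eqP => /form_eq0; apply: root_neq0.
Qed.

(** In matrix form [form] reads [x Q y^T], and a coroot is [2 / (beta, beta)]
    times the root [beta] times [Q].  The factors [h] clear the denominators, so
    that relations between coroots become relations between roots. *)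
Lemma root_relation (h : 'I_D -> int) (b : int) (I : Type) (r : seq I)
    (a : I -> int) (g : I -> 'I_D) :
  (forall j, h j * form (al j) (al j) = b) ->
  \sum_(i <- r) a i *: cal (g i) = 0 ->
  \sum_(i <- r) (a i * h (g i)) *: al (g i) = 0.
Proof.
move=> hb rel; apply: form_nondeg => z; apply: (@mulfI _ 2) => //.
transitivity (b * pairing z (\sum_(i <- r) a i *: cal (g i))); last first.
  by rewrite rel pairingC pairing0l !mulr0.
rewrite form_sumr pairing_sumr !mulr_sumr; apply: eq_bigr => i _.
rewrite formZr pairingZr -(hb (g i)) mulrCA -[X in _ * X]form_proot; ring.
Qed.

Lemma form_clear : exists2 b : int, b != 0 &
  exists h : 'I_D -> int, forall j, h j * form (al j) (al j) = b.
Proof.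
have q0 j : form (al j) (al j) != 0 
  by rewrite gt_eqF // (form_root_gt0 (false, j)).
exists (\prod_j form (al j) (al j)); first by apply/prodf_neq0.
exists (fun j => \prod_(l | l != j) form (al l) (al l)) => j.
by rewrite [RHS](bigD1 j) //= mulrC.
Qed.

(** With [form x y = x Q y^T], the vector [z Q] is the combination
    [\sum_s <z, s^vee> s^vee] of coroots, and [s^vee Q^-1] is a multiple of the
    root of [s]. *)
Lemma roots_span_rationally z : exists2 b : int, b != 0 &
  exists d : bool * 'I_D -> int, b *: z = \sum_s d s *: rt s.
Proof.
have [b b0 [h hb]] := form_clear; exists b => //.
exists (fun s => 2 * h s.2 * pairing z (crt s)).
apply/eqP; rewrite -subr_eq0; apply/eqP/form_nondeg => x.
rewrite -scaleN1r formDr !formZr form_sumr mulr_sumr [X in _ + X]mulr_sumr.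
rewrite -big_split big1 //= => s _; rewrite formZr.
have := form_root s x; set c := form x _.
have -> : form (rt s) (rt s) = form (al s.2) (al s.2).
  case: s {c} => [[] i]; rewrite /Defs.root /signed //=.
  by rewrite -scaleN1r formZl formZr !mulN1r opprK.
move=> e; rewrite -(hb s.2).
transitivity (h s.2 * pairing z (crt s) *
  (form (al s.2) (al s.2) * pairing x (crt s) - 2 * c)); first by ring.
by rewrite e subrr mulr0.
Qed.

Lemma root_span0 (P : {set bool * 'I_D}) : root_span Phi P 0.
Proof. by exists (fun=> 0); rewrite big1 // => s _; rewrite scale0r. Qed.

Lemma root_spanD (P : {set bool * 'I_D}) x y :
  root_span Phi P x -> root_span Phi P y -> root_span Phi P (x + y).
Proof.
move=> [c ->] [d ->]; exists (fun s => c s + d s).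
by rewrite -big_split; apply: eq_bigr => s _; rewrite scalerDl.
Qed.

Lemma root_spanZ (P : {set bool * 'I_D}) (a : int) i :
  (false, i) \in P -> root_span Phi P (a *: al i).
Proof.
move=> iP; exists (fun s => a *+ (s == (false, i))).
rewrite (bigD1 (false, i)) //= eqxx big1 ?addr0 // => s /andP[_ /negPf->].
by rewrite scale0r.
Qed.

(** The roots whose squared length is divisible by a given power of [p] form a
    closed subsystem.  Goodness of [p] makes this subsystem stable under passing
    to non-orthogonal roots, because [<alpha, beta^vee> beta] is the difference
    of [alpha] and its reflection. *)
Lemma dvd_form_step p e s i : prime p -> good_prime Phi p ->
  ((p ^ e)%N%:Z %| form (rt s) (rt s))%Z -> pairing (rt s) (cal i) <> 0 ->
  ((p ^ e)%N%:Z %| form (al i) (al i))%Z.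
Proof.
move=> pp good; set q := (p ^ e)%N%:Z => ds pr.
pose P := [set t | (q %| form (rt t) (rt t))%Z].
(* divisibility of all [2 (z, x)] controls the cross terms *)
pose K x := (q %| form x x)%Z /\ forall z, (q %| 2 * form z x)%Z.
have KP t : t \in P -> K (rt t).
  by rewrite inE => dt; split=> // z; rewrite -form_root dvdz_mulr.
have KD x y : K x -> K y -> K (x + y).
  move=> [kx kx'] [ky ky']; split=> [|z]; last by rewrite formDr mulrDr rpredD.
  rewrite (_ : form _ _ = form x x + (2 * form x y + form y y)).
    by rewrite !rpredD.
  by rewrite formDl !formDr [form y x]formC; ring.
have KZ a x : K x -> K (a *: x).
  move=> [kx kx']; split=> [|z]; first by rewrite formZl formZr !dvdz_mull.
  by rewrite formZr mulrCA dvdz_mull.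
have closedP : closed_subsystem Phi P.
  split=> [t|t u v tP uP ev].
    by rewrite !inE root_neg -scaleN1r formZl formZr !mulN1r opprK.
  by rewrite inE ev; case: (KD _ _ (KP _ tP) (KP _ uP)).
pose a := pairing (rt s) (cal i).
have sP : s \in P by rewrite inE.
have tP : refl_index i s \in P.
  by rewrite inE (refl_indexP i s).1 form_refl.
have span1 : root_span Phi P (a *: al i).
  exists (fun t => (t == s)%:Z - (t == refl_index i s)%:Z).
  under eq_bigr do rewrite scalerBl.
  rewrite sumrB (bigD1 s) //= eqxx scale1r big1; last first.
    move=> t /andP[_ /negPf->].
    by rewrite scale0r.
  rewrite (bigD1 (refl_index i s)) //= eqxx scale1r big1.
    by rewrite !addr0 (refl_indexP i s).1 /refl_vec opprB addrC subrK.
  move=> t /andP[_ /negPf->].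
  by rewrite scale0r.
have spanT (z : int) : root_span Phi setT (z *: al i).
  by apply: root_spanZ; rewrite inE.
(* goodness removes all factors [p] from the coefficient of [al i] *)
have [b [bp spanb]] : exists b : int,
    ~~ (p%:Z %| b)%Z /\ root_span Phi P (b *: al i).
  have [N] : exists N, (`|a| <= N)%N by exists `|a|%N.
  move: pr span1; rewrite -/a; elim: N a => [|N IH] b b0 sb bN.
    by move: bN; rewrite leqn0 absz_eq0 => /eqP.
  have [/dvdzP[b' eb]|nd] := boolP (p%:Z %| b)%Z; last by exists b.
  have p1 := prime_gt1 pp.
  apply: (IH b'); first by move=> b'0; apply: b0; rewrite eb b'0 mul0r.
    by apply: good closedP _ (spanT _) _; rewrite scalerA mulrC -eb.
  have : (0 < `|b'|)%N.
    by rewrite absz_gt0; apply/eqP => b'0; apply: b0; rewrite eb b'0 mul0r.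
  by move: bN; rewrite eb abszM absz_nat; nia.
have [d _] : K (b *: al i).
  case: spanb => d ->; apply: big_ind => //; last by move=> t /KP/KZ.
  by split=> [|z]; rewrite ?form0l ?[form _ 0]formC ?form0l ?mulr0 dvdz0.
move: d; rewrite formZl formZr mulrA Gauss_dvdzr //.
rewrite coprimezE /= coprimeXl // abszM coprimeMr andbb prime_coprime //.
Qed.

(** Irreducibility propagates the divisibility to all roots: for a good prime,
    all squared root lengths have the same [p]-adic valuation. *)
Lemma dvd_form_all p e i j : prime p -> good_prime Phi p ->
  ((p ^ e)%N%:Z %| form (al i) (al i))%Z ->
  ((p ^ e)%N%:Z %| form (al j) (al j))%Z.
Proof.
move=> pp good di; pose P := [set l | ((p ^ e)%N%:Z %| form (al l) (al l))%Z].
suff /setP/(_ j) : P = setT by rewrite !inE.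
apply: (@root_irreducible _ _ Phi).
  by apply/set0Pn; exists i; rewrite inE.
move=> l l'; rewrite !inE => dl ndl'; apply/eqP.
apply: contraNT ndl' => /eqP nz.
exact: (@dvd_form_step _ _ (false, l)).
Qed.

Definition independent_roots N (f : 'I_N -> 'I_D) : Prop :=
  forall z : 'I_N -> int, \sum_i z i *: al (f i) = 0 -> forall i, z i = 0.

Lemma coroot_independent N (f : 'I_N -> 'I_D) : independent_roots f ->
  forall z : 'I_N -> int, \sum_i z i *: cal (f i) = 0 -> forall i, z i = 0.
Proof.
move=> indep z rel i; have [b b0 [h hb]] := form_clear.
have /eqP := indep _ (root_relation hb rel) i.
rewrite mulf_eq0 => /orP[/eqP //|/eqP h0].
by move: b0; rewrite -(hb (f i)) h0 mul0r eqxx.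
Qed.

(** After division of all squared lengths by their common power of [p], passing
    to roots multiplies the coefficients of the relation by numbers prime to
    [p].  The relation then says that [p] times an element of the root lattice
    lies in the span of the roots [f i]; goodness for the closed subsystem of the
    roots in that span puts the element itself in the span. *)
Lemma coroot_independent_mod p N (f : 'I_N -> 'I_D) : prime p ->
  good_prime Phi p -> independent_roots f ->
  forall (z : 'I_N -> int) y, \sum_i z i *: cal (f i) = p%:Z *: y ->
  forall i, (p%:Z %| z i)%Z.
Proof.
move=> pp good indep z y rel i0.
pose q j := form (al j) (al j).
have q_gt0 j : 0 < q j by exact: (form_root_gt0 (false, j)).
pose e := logn p `|q (f i0)|.
pose u j := (q j %/ (p ^ e)%N%:Z)%Z.
have qE j : q j = u j * (p ^ e)%N%:Z.
  rewrite divzK //; apply: (@dvd_form_all _ _ (f i0)) => //.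
  by rewrite dvdzE /= pfactor_dvdnn.
have u_coprime j : coprime p `|u j|.
  rewrite prime_coprime //; apply/negP => /dvdnP[c uc].
  have : ((p ^ e.+1)%N%:Z %| q (f i0))%Z.
    apply: (@dvd_form_all _ _ j) => //.
    by rewrite dvdzE -/(q j) qE abszM uc /= -mulnA -expnS dvdn_mull.
  rewrite dvdzE /= pfactor_dvdn ?ltnn //.
  by rewrite absz_gt0 gt_eqF.
pose h j := \prod_(l | l != j) u l.
have hq j : h j * q j = (\prod_l u l) * (p ^ e)%N%:Z.
  by rewrite (bigD1 j) //= qE mulrA [h j * _]mulrC.
have h_coprime j : coprimez p%:Z (h j).
  rewrite coprimezE /h; apply: (big_ind (fun a : int => coprime p `|a|)) => //=.
  - exact: coprimen1.
  - by move=> a b ca cb; rewrite abszM coprimeMr ca.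
have [d yE] := coroot_span Phi y.
(* [y] is expanded in coroots to obtain a relation between coroots only *)
pose g (s : 'I_N + 'I_D) := match s with inl i => f i | inr j => j end.
pose a (s : 'I_N + 'I_D) :=
  match s with inl i => z i | inr j => - (p%:Z * d j) end.
have rel2 : \sum_(s : 'I_N + 'I_D) a s *: cal (g s) = 0.
  rewrite big_sumType /= rel yE scaler_sumr -big_split big1 //= => j _.
  by rewrite scalerA scaleNr subrr.
have := root_relation hq rel2; rewrite big_sumType /=.
under [X in _ + X]eq_bigr do rewrite mulNr -mulrA scaleNr -scalerA.
rewrite sumrN -scaler_sumr => /eqP; rewrite subr_eq0 => /eqP rel3.
pose w : 'rV[int]_n := \sum_j (d j * h j) *: al j; rewrite -/w in rel3.
pose span x := exists c : 'I_N -> int, x = \sum_i c i *: al (f i).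
have spanD x x' : span x -> span x' -> span (x + x').
  move=> [c ->] [c' ->]; exists (fun i => c i + c' i).
  by rewrite -big_split; apply: eq_bigr => i _; rewrite scalerDl.
have spanZ b x : span x -> span (b *: x).
  move=> [c ->]; exists (fun i => b * c i).
  by rewrite scaler_sumr; apply: eq_bigr => i _; rewrite scalerA.
pose P := [set s | `[< span (rt s) >]] : {set bool * 'I_D}.
have closedP : closed_subsystem Phi P.
  split=> [s|s t v]; rewrite !inE.
    move=> /asboolP sp; apply/asboolP.
    by rewrite root_neg -scaleN1r; apply: spanZ.
  by move=> /asboolP ss /asboolP st ev; apply/asboolP; rewrite ev; apply: spanD.
have fP i : (false, f i) \in P.
  rewrite inE; apply/asboolP; exists (fun i' => (i' == i)%:Z).
  rewrite (bigD1 i) //= eqxx scale1r big1 ?addr0 // => i' /negPf->.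
  by rewrite scale0r.
have spanw : root_span Phi P w.
  apply: good closedP _ _ _.
    apply: big_ind => [|x x'|j _]; [exact: root_span0 | exact: root_spanD |].
    by apply: root_spanZ; rewrite inE.
  have -> : p%:Z *: w = \sum_i (z i * h (f i)) *: al (f i) by rewrite rel3.
  apply: big_ind => [|x x'|i _].
  - exact: root_span0.
  - exact: root_spanD.
  - exact: root_spanZ (fP i).
have [c wE] : span w.
  have span0 : span 0.
    by exists (fun=> 0); rewrite big1 // => t _; rewrite scale0r.
  case: spanw => c ->; apply: big_ind => // t.
  by rewrite inE => /asboolP/spanZ.
move: rel3; rewrite {}wE scaler_sumr => /eqP.
rewrite -subr_eq0 -sumrB => /eqP.
under eq_bigr do rewrite scalerA -scalerBl.
move/indep/(_ i0)/eqP; rewrite subr_eq0 => /eqP zh.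
by rewrite -(Gauss_dvdzl _ (h_coprime (f i0))) zh dvdz_mulr.
Qed.

(** A determinant vanishing in [k] but not in [int] is divisible by the
    characteristic [p]; a linear relation between the rows over the prime field
    then lifts to an integral relation modulo [p] between coroots. *)
Lemma det_coroots_neq0 (k : fieldType) (f : 'I_n -> 'I_D) :
  good_characteristic Phi k -> independent_roots f ->
  \det (\matrix_(i < n) map_mx intr (cal (f i)) : 'M[k]_n) != 0.
Proof.
move=> good indep; pose C : 'M[int]_n := \matrix_i cal (f i).
have -> : \matrix_(i < n) map_mx intr (cal (f i)) = map_mx intr C :> 'M[k]_n.
  by apply/matrixP => i j; rewrite !mxE.
rewrite det_map_mx.
have mulC (v : 'rV[int]_n) : v *m C = \sum_i v 0 i *: cal (f i).
  by rewrite mulmx_sum_row; apply: eq_bigr => i _; rewrite rowK.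
have detC0 : \det C != 0.
  apply/det0P => -[v v0]; rewrite mulC => /(coroot_independent indep) vz.
  by case/eqP: v0; apply/rowP => i; rewrite vz mxE.
apply/negP => det0.
have [p pk] : exists p, p \in [pchar k].
  apply: (@natf0_pchar _ `|\det C|); first by rewrite absz_gt0.
  move: det0; rewrite {1}[\det C]intEsign rmorphM rmorph_sign mulf_eq0.
  by rewrite signr_eq0 pmulrn.
have pp := pcharf_prime pk.
have pdet : (p%:Z %| \det C)%Z by rewrite (dvdz_pcharf pk).
have : \det (map_mx intr C : 'M['F_p]_n) == 0.
  by rewrite det_map_mx -(dvdz_pcharf (pchar_Fp pp)).
case/det0P => v v0 vC.
pose z i : int := (v 0 i : nat)%:Z.
have zv i : (z i)%:~R = v 0 i by rewrite /z -pmulrn natr_Zp.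
suff zp i : (p%:Z %| z i)%Z.
  case/eqP: v0; apply/rowP => i; rewrite -zv mxE; apply/eqP.
  by rewrite -(dvdz_pcharf (pchar_Fp pp)).
have dv j : (p%:Z %| (\sum_i z i *: cal (f i))%R 0%R j)%Z.
  rewrite (dvdz_pcharf (pchar_Fp pp)) summxE rmorph_sum /=; apply/eqP.
  transitivity ((v *m map_mx intr C) 0 j); last by rewrite vC mxE.
  by rewrite mxE; apply: eq_bigr => l _; rewrite !mxE rmorphM /= zv.
apply: (coroot_independent_mod pp (good p pk) indep
         (y := \row_j ((\sum_i z i *: cal (f i))%R 0%R j %/ p%:Z)%Z)).
by apply/rowP => j; rewrite mxE mxE mulrC divzK.
Qed.

(** If a nonempty set of hyperplanes intersects in more than the origin, its
    intersection is an element of the lattice distinct from both extremes, and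
    makes the set of hyperplanes a face; hence the roots of a non-face have no
    common zero but the origin, so they span the dual space and contain a basis
    of it. *)
Lemma nonface_basis (R : realType) (S : {set 'I_D}) : ~ nerve_face Phi R S ->
  exists f : 'I_n -> 'I_D,
    [/\ injective f, forall i, f i \in S & independent_roots f].
Proof.
move=> nf.
pose W := (\bigcap_(i in S) Omega Phi R i)%VS.
have inOmega i (x : 'rV[R]_n) :
    (x \in Omega Phi R i) = (x *m (map_mx intr (al i))^T == 0).
  by rewrite memv_ker lfunE.
have W0 (x : 'rV[R]_n) : x \in W -> x = 0.
  move=> xW.
  have xall i : x \in Omega Phi R i.
    have [WE|WN] := eqVneq W (\bigcap_(i < D) Omega Phi R i)%VS.
      by move: xW; rewrite WE memvE => /subv_bigcapP/(_ i isT); rewrite memvE.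
    case: nf; have [->|/set0Pn[j jS]] := eqVneq S set0; first by left.
    right; exists W; last by move=> l lS; apply: bigcapv_inf lS _.
    split; [by exists S | | exact/eqP].
    move=> Wfull; have : map_mx intr (cal j) \in W by rewrite Wfull memvf.
    rewrite memvE => /subv_bigcapP/(_ j jS); rewrite -memvE inOmega.
    have := root_coroot2 Phi j; rewrite /pairing => e.
    move/eqP/matrixP/(_ 0 0)/eqP; rewrite !mxE.
    under eq_bigr do rewrite !mxE -rmorphM /= mulrC.
    by rewrite -rmorph_sum /= e intr_eq0.
  have pz (z : 'rV[int]_n) : x *m (map_mx intr z)^T = 0.
    have [b b0 [d]] := roots_span_rationally z.
    move=> /(congr1 (fun z => x *m (map_mx intr z)^T)).
    rewrite map_mxZ linearZ /= -scalemxAr => be.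
    apply/eqP; rewrite -(inj_eq (scalerI (a := b%:~R) _)) ?intr_eq0 //.
    rewrite be scaler0.
    rewrite raddf_sum linear_sum mulmx_sumr big1 //= => s _.
    rewrite map_mxZ linearZ /= -scalemxAr.
    suff -> : x *m (map_mx intr (rt s))^T = 0 by rewrite scaler0.
    have := xall s.2; rewrite inOmega.
    case: s => [[] i]; rewrite /Defs.root /signed /= => /eqP h //.
    by rewrite map_mxN linearN /= mulmxN h oppr0.
  apply/rowP => j; have /matrixP/(_ 0 0) := pz (delta_mx 0 j).
  by rewrite map_delta_mx trmx_delta -colE !mxE.
pose B : 'M[R]_(D, n) := \matrix_i (if i \in S then map_mx intr (al i) else 0).
have Bfull : row_full B.
  rewrite /row_full -mxrank_tr; apply: inj_row_free => v vB.
  apply: W0; rewrite memvE; apply/subv_bigcapP => i iS; rewrite -memvE inOmega.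
  apply/eqP/matrixP => a b; rewrite !ord1.
  have := congr1 (fun M : 'rV[R]_D => M 0 i) vB; rewrite !mxE => e.
  by rewrite -[RHS]e; apply: eq_bigr => l _; rewrite !mxE iS !mxE.
have Bunit := fullrowsub_unit Bfull.
pose f := fullrankfun Bfull.
have fS i : f i \in S.
  apply/negPn/negP => niS; move: Bunit; rewrite unitmxE unitfE => /det0P; case.
  exists (delta_mx 0 i).
    by apply/eqP => /matrixP/(_ 0 i)/eqP; rewrite !mxE !eqxx oner_eq0.
  by rewrite -rowE; apply/rowP => j; rewrite !mxE (negPf niS) !mxE.
exists f; split=> //; first exact: fullrankfun_inj.
move=> z rel i; have : (\row_i (z i)%:~R : 'rV[R]_n) = 0.
  apply: (row_free_inj (A := rowsub f B)); first by rewrite row_free_unit.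
  rewrite mul0mx; apply/rowP => j.
  have := congr1 (fun M : 'rV[int]_n => (M 0 j)%:~R : R) rel.
  rewrite summxE rmorph_sum !mxE /= => e; rewrite -[RHS]e.
  by apply: eq_bigr => l _; rewrite !mxE fS !mxE rmorphM.
by move/rowP/(_ i); rewrite !mxE => /eqP; rewrite intr_eq0 => /eqP.
Qed.

End RootDatum.

(** * Divided powers of the adjoint action of a root vector *)

Section Commutator.

Variable m : nat.
Implicit Types X Y : 'M[int]_m.

Lemma commutator0r X : commutator X 0 = 0.
Proof. by rewrite /commutator mulmx0 mul0mx subr0. Qed.

Lemma commutatorZr a X Y : commutator X (a *: Y) = a *: commutator X Y.
Proof. by rewrite /commutator -scalemxAr -scalemxAl -scalerBr. Qed.

Lemma commutatorxx X : commutator X X = 0.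
Proof. exact: subrr. Qed.

Lemma commutatorC X Y : commutator X Y = - commutator Y X.
Proof. by rewrite /commutator opprB. Qed.

Lemma scaleS_inj p (r : nat) (X Y : 'M[int]_(m, p)) :
  r.+1%:Z *: X = r.+1%:Z *: Y -> X = Y.
Proof.
move=> /matrixP e; apply/matrixP => i j.
by have := e i j; rewrite !mxE => /mulfI; apply.
Qed.

End Commutator.

Lemma sum_antidiagonal (W : nmodType) N (F : nat -> nat -> W) :
  (forall p q, (N <= p + q)%N -> F p q = 0) ->
  \sum_(p < N) \sum_(q < N) F p q = \sum_(r < N) \sum_(p < r.+1) F p (r - p)%N.
Proof.
move=> F0.
transitivity (\sum_(p < N) \sum_(r < N | (p <= r)%N) F p (r - p)%N).
  apply: eq_bigr => p _; rewrite -(big_mkord xpredT (F p)).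
  rewrite -(big_mkord (fun r => (p <= r)%N) (fun r => F p (r - p)%N)).
  rewrite [RHS](@big_cat_nat _ _ _ p) //=; last exact: ltnW.
  rewrite [X in _ = X + _]big_nat_cond [X in _ = X + _]big_pred0; last first.
    move=> r.
    by case: leqP; rewrite ?andbF.
  rewrite add0r (_ : index_iota p N = index_iota (0 + p) N) // big_addn.
  rewrite (@big_cat_nat _ _ _ (N - p)) ?leq_subr //= [X in _ + X]big_nat_cond.
  rewrite [X in _ + X]big1 ?addr0 => [|q]; last first.
    by rewrite andbT leq_subLR => /andP[/F0].
  by apply: eq_big => [q|q _]; rewrite ?leq_addl ?addnK.
rewrite (exchange_big_dep xpredT) //=; apply: eq_bigr => r _.
rewrite -(big_mkord xpredT (fun p => F p (r - p)%N)).
rewrite -(big_mkord (fun p => (p <= r)%N) (fun p => F p (r - p)%N)).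
rewrite (@big_cat_nat _ _ _ r.+1) //= [X in _ + X]big_nat_cond.
rewrite [X in _ + X]big_pred0 ?addr0 => [|p]; last first.
  by rewrite ltnNge; case: (p <= r)%N; rewrite ?andbF.
by rewrite !big_nat; apply: eq_bigl => p; rewrite ltnS; case: leqP.
Qed.

Section Representation.

Variables (n D : nat) (Phi : sc_root_datum n D) (m : nat).
Variable V : sc_chevalley_rep Phi m.
Local Notation rt := (Defs.root Phi).
Local Notation al := (proot Phi).
Local Notation cal := (pcoroot Phi).
Local Notation tor := (toral (wt V)).
Local Notation dp := (divided_power V).
Implicit Types (s t : bool * 'I_D).

(** Root vectors shift the weights, also after reduction modulo a prime that
    does not separate the weights. *)
Lemma chev_graded s i j : chev V s i j != 0 -> wt V i - wt V j = rt s.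
Proof.
move=> nz; apply: pairing_eq => y; apply: (mulIf nz).
have /matrixP/(_ i j) := chev_toral V y s.
rewrite /commutator mul_diag_mx mul_mx_diag !mxE pairingBl => <-.
by rewrite mulrBl [chev V s i j * _]mulrC.
Qed.

Lemma chev_pow_chain s r i j : (chev V s ^+ r) i j != 0 ->
  forall l, (l <= r)%N -> exists i', wt V i' = wt V j + l%:Z *: rt s.
Proof.
suff chain : (chev V s ^+ r) i j != 0 -> wt V i = wt V j + r%:Z *: rt s /\
    forall l, (l <= r)%N -> exists i', wt V i' = wt V j + l%:Z *: rt s.
  by move=> /chain[].
elim: r i => [|r IH] i.
  rewrite expr0 -[1]/(1%:M) mxE; case: (i =P j) => [->|_] /=; last by [].
  rewrite scale0r addr0; split=> // l; rewrite leqn0 => /eqP->.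
  by exists j; rewrite scale0r addr0.
rewrite exprS -mulmxE mxE => nz.
have [i' nz'] : exists i', chev V s i i' * (chev V s ^+ r) i' j != 0.
  apply/existsP; apply: contraR nz => /existsPn z; apply/eqP/big1 => i' _.
  by apply/eqP; have := z i'; rewrite negbK.
move: nz'; rewrite mulf_eq0 negb_or => /andP[/chev_graded e1 /IH[e2 ch]].
have wi : wt V i = wt V j + r.+1%:Z *: rt s.
  by rewrite -[LHS](subrK (wt V i')) e1 e2 intS scalerDl scale1r addrCA.
split=> // l; rewrite leq_eqVlt => /orP[/eqP->|]; first by exists i.
exact: ch.
Qed.

Lemma chev_nilpotent s r : (m <= r)%N -> chev V s ^+ r = 0.
Proof.
move=> mr; apply/matrixP => i j; rewrite [RHS]mxE; apply/eqP/negPn/negP => nz.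
have ch (l : 'I_r.+1) : exists i', wt V i' == wt V j + (l : nat)%:Z *: rt s.
  have [|i' e] := chev_pow_chain nz (l := l); first by rewrite -ltnS.
  by exists i'; apply/eqP.
pose g l := xchoose (ch l).
have g_inj : injective g.
  move=> l l' e; have /eqP := xchooseP (ch l); rewrite -/(g l) e.
  rewrite (eqP (xchooseP (ch l'))) => /addrI.
  move=> /(congr1 (fun x => pairing x (coroot Phi s))).
  by rewrite !pairingZl pairing_root_coroot => /(@mulIf int 2 isT)[/val_inj].
by have := leq_card g g_inj; rewrite !card_ord ltnNge mr.
Qed.

Lemma divided_powerE s r : (r`!)%:Z *: dp s r = chev V s ^+ r.
Proof.
by apply/matrixP => i j; rewrite !mxE mulrC divzK // chev_divided.
Qed.

Lemma divided_power0 s : dp s 0 = 1%:M.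
Proof. by have := divided_powerE s 0; rewrite fact0 scale1r expr0. Qed.

Lemma divided_power_big s r : (m <= r)%N -> dp s r = 0.
Proof.
move=> mr; apply/matrixP => i j; rewrite mxE (chev_nilpotent s mr) !mxE.
by rewrite div0z.
Qed.

Lemma factZ_inj r (X Y : 'M[int]_m) : (r`!)%:Z *: X = (r`!)%:Z *: Y -> X = Y.
Proof. by rewrite -(prednK (fact_gt0 r)); apply: scaleS_inj. Qed.

Lemma mul_chev_divided_power s r : chev V s *m dp s r = r.+1%:Z *: dp s r.+1.
Proof.
apply: (@factZ_inj r).
rewrite scalemxAr divided_powerE scalerA -PoszM mulnC -factS.
by rewrite divided_powerE exprS.
Qed.

Lemma mul_divided_power_chev s r : dp s r *m chev V s = r.+1%:Z *: dp s r.+1.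
Proof.
apply: (@factZ_inj r).
rewrite scalemxAl divided_powerE scalerA -PoszM mulnC -factS.
by rewrite divided_powerE exprSr.
Qed.

(** The divided power [(ad e)^r / r!] of the adjoint action of a root vector. *)
Definition ad_divided s r (C : 'M[int]_m) : 'M[int]_m :=
  \sum_(p < r.+1) (-1) ^+ (r - p) *: (dp s p *m C *m dp s (r - p)).

Lemma ad_divided0 s C : ad_divided s 0 C = C.
Proof.
rewrite /ad_divided big_ord1 subn0 expr0 scale1r divided_power0.
by rewrite mul1mx mulmx1.
Qed.

(** In the summand of index [p] on the left, [r + 1] is split as
    [p + (r + 1 - p)]; the two parts come from multiplication by the root vector
    on either side. *)
Lemma ad_dividedS s r C :
  r.+1%:Z *: ad_divided s r.+1 C = commutator (chev V s) (ad_divided s r C).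
Proof.
pose F p q := dp s p *m C *m dp s q.
transitivity (\sum_(p < r.+2) (p%:Z * (-1) ^+ (r.+1 - p)) *: F p (r.+1 - p)%N +
  \sum_(p < r.+2) ((r.+1 - p)%N%:Z * (-1) ^+ (r.+1 - p)) *: F p (r.+1 - p)%N).
  rewrite -big_split scaler_sumr; apply: eq_bigr => p _.
  by rewrite /= -scalerDl -mulrDl -PoszD subnKC ?scalerA // -ltnS.
rewrite big_ord_recl mul0r scale0r add0r [X in _ + X]big_ord_recr /=.
rewrite subnn mul0r scale0r addr0 /commutator mulmx_sumr mulmx_suml -sumrB.
rewrite -big_split.
apply: eq_bigr => p _ /=; have pr : (p <= r)%N by rewrite -ltnS.
rewrite /bump leq0n add1n subSS subSn // -scalemxAr -scalemxAl.
rewrite !mulmxA mul_chev_divided_power -[_ *m dp s _ *m chev V s]mulmxA.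
rewrite mul_divided_power_chev -!scalemxAl -scalemxAr !scalerA -/(F _ _).
by rewrite exprS mulN1r mulrN scaleNr mulrC [_ * (-1) ^+ _]mulrC.
Qed.

Lemma ad_divided_step s r C a B : ad_divided s r C = a *: B ->
  r.+1%:Z *: ad_divided s r.+1 C = a *: commutator (chev V s) B.
Proof. by rewrite ad_dividedS => ->; rewrite commutatorZr. Qed.

Lemma ad_divided_eq0 s r C r' :
  ad_divided s r C = 0 -> (r <= r')%N -> ad_divided s r' C = 0.
Proof.
move=> e; elim: r' => [|r' IH]; first by rewrite leqn0 => /eqP<-.
rewrite leq_eqVlt => /orP[/eqP<- //|/IH e']; apply: (@scaleS_inj _ _ r').
by rewrite ad_dividedS e' commutator0r scaler0.
Qed.

Lemma ad_divided_1 s r : ad_divided s r.+1 1%:M = 0.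
Proof.
apply: (@ad_divided_eq0 _ 1%N) => //; apply: (@scaleS_inj _ _ 0).
by rewrite ad_dividedS ad_divided0 /commutator mulmx1 mul1mx subrr scaler0.
Qed.

Lemma ad_divided_toral1 s y :
  ad_divided s 1 (tor y) = - pairing (rt s) y *: chev V s.
Proof.
rewrite -[LHS]scale1r -[1]/(1%:Z) ad_dividedS ad_divided0 commutatorC.
by rewrite chev_toral scaleNr.
Qed.

Lemma ad_divided_toral2 s y r : ad_divided s r.+2 (tor y) = 0.
Proof.
apply: (@ad_divided_eq0 _ 2%N) => //; apply: (@scaleS_inj _ _ 1).
by rewrite (ad_divided_step (ad_divided_toral1 s y)) commutatorxx !scaler0.
Qed.

Lemma ad_divided_opp1 i :
  ad_divided (false, i) 1 (chev V (true, i)) = tor (cal i).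
Proof.
by rewrite -[LHS]scale1r -[1]/(1%:Z) ad_dividedS ad_divided0 chev_opp.
Qed.

Lemma ad_divided_opp2 i :
  ad_divided (false, i) 2 (chev V (true, i)) = - chev V (false, i).
Proof.
apply: (@scaleS_inj _ _ 1); rewrite ad_dividedS ad_divided_opp1 commutatorC.
by rewrite chev_toral root_coroot2 scalerN.
Qed.

Lemma ad_divided_opp3 i r : ad_divided (false, i) r.+3 (chev V (true, i)) = 0.
Proof.
apply: (@ad_divided_eq0 _ 3%N) => //; apply: (@scaleS_inj _ _ 2).
rewrite ad_dividedS ad_divided_opp2 -scaleN1r commutatorZr commutatorxx.
by rewrite !scaler0.
Qed.

Definition is_rootb (x : 'rV[int]_n) := [exists s, x == rt s].

Lemma is_rootP x : reflect (is_root Phi x) (is_rootb x).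
Proof.
by apply: (iffP existsP) => -[s /eqP]; exists s => //; apply/eqP.
Qed.

Lemma root_string_bottom s t : exists r : nat,
  is_root Phi (rt t - r%:Z *: rt s) /\
  forall q : nat, is_root Phi (rt t - q%:Z *: rt s) -> (q <= r)%N.
Proof.
have ex0 : exists q : nat, is_rootb (rt t - q%:Z *: rt s).
  by exists 0%N; apply/is_rootP; exists t; rewrite scale0r subr0.
pose M := (\sum_u `|pairing (rt u) (coroot Phi s)|)%N.
have ubd (q : nat) : is_rootb (rt t - q%:Z *: rt s) -> (q <= M + M)%N.
  move=> /is_rootP[u e].
  have leM v : (`|pairing (rt v) (coroot Phi s)| <= M)%N.
    by rewrite /M (bigD1 v) //= leq_addr.
  have := leM u; have := leM t.
  by rewrite -e pairingBl pairingZl pairing_root_coroot; lia.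
case: (ex_maxnP ex0 ubd) => r /is_rootP rr rmax; exists r.
by split=> // q /is_rootP; apply: rmax.
Qed.

(** The structure constants [+- (r + 1)] along a root string multiply to
    [r!] times a binomial coefficient; this is why [(ad e)^r / r!] preserves the
    integral span of the Chevalley basis. *)
Lemma ad_divided_chev s t r : t <> neg_index s ->
  ad_divided s r (chev V t) = 0 \/
  exists u (a : int), rt u = rt t + r%:Z *: rt s /\
    ad_divided s r (chev V t) = a *: chev V u.
Proof.
move=> ts; have [r0 [r0root r0max]] := root_string_bottom s t.
suff : ad_divided s r (chev V t) = 0 \/
  exists u (b : bool), rt u = rt t + r%:Z *: rt s /\
    ad_divided s r (chev V t) = ((-1) ^+ b * 'C(r0 + r, r)%:Z) *: chev V u.
  case=> [->|[u [b e]]]; first by left.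
  by right; exists u, ((-1) ^+ b * 'C(r0 + r, r)%:Z).
elim: r => [|r [IH|[u [b [ru IH]]]]].
- right; exists t, false; rewrite scale0r addr0 ad_divided0 bin0.
  by rewrite expr0 mulr1 scale1r.
- by left; apply: ad_divided_eq0 IH _.
have step := ad_divided_step IH.
have su : rt s + rt u = rt t + r.+1%:Z *: rt s.
  by rewrite ru addrCA intS scalerDl scale1r.
have shift (q : int) : rt u - q *: rt s = rt t - (q - r%:Z) *: rt s.
  by rewrite ru scalerBl opprB addrA.
have su0 : rt s + rt u <> 0.
  rewrite su => /eqP; rewrite addr_eq0 => /eqP e.
  have r00 := root_multiple_neg e.
  by apply: ts; apply: (@root_inj _ _ Phi); rewrite e r00 scale1r root_neg.
have [/is_rootP[x xE]|nr] := boolP (is_rootb (rt s + rt u)); last first.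
  left; apply: (@scaleS_inj _ _ r); rewrite step chev_comm ?scaler0 //.
  by move=> /is_rootP; apply/negP.
right; exists x.
have [b' cE] : exists b' : bool,
    commutator (chev V s) (chev V u) =
    ((-1) ^+ b' * (r0 + r).+1%:Z) *: chev V x.
  have [||e|e] := @chev_add _ _ _ _ V s u x (r0 + r)%N (esym xE).
  + by rewrite shift PoszD addrK.
  + move=> q; rewrite shift; have [qr _|/ltnW rq] := leqP q r.
      by rewrite (leq_trans qr) // leq_addl.
    by rewrite subzn // => /r0max; rewrite leq_subLR addnC.
  + by exists false; rewrite e mul1r.
  + by exists true; rewrite e expr1 mulN1r scaleNr.
exists (b (+) b'); split; first by rewrite -su xE.
apply: (@scaleS_inj _ _ r); rewrite step cE !scalerA; congr (_ *: _).
rewrite signr_addb mulrACA [RHS]mulrCA -!PoszM.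
by rewrite addnS -mul_bin_diag mulnC.
Qed.

End Representation.

(** * The adjoint action of the unipotent group *)

Section Points.

Variables (n D : nat) (Phi : sc_root_datum n D) (m : nat).
Variables (V : sc_chevalley_rep Phi m) (k : fieldType) (A : comUnitAlgType k).
Local Notation rt := (Defs.root Phi).
Local Notation al := (proot Phi).
Local Notation cal := (pcoroot Phi).
Local Notation tor := (toral (wt V)).
Local Notation dp := (divided_power V).
Implicit Types (s t : bool * 'I_D) (x : A) (C : 'M[A]_m).

Definition chev_pt s : 'M[A]_m := map_mx intr (chev V s).

Definition toral_pt (b : 'rV[A]_n) : 'M[A]_m :=
  \sum_l b 0 l *: map_mx intr (tor (delta_mx 0 l)).

Lemma toral_ptD b b' : toral_pt (b + b') = toral_pt b + toral_pt b'.
Proof.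
by rewrite -big_split; apply: eq_bigr => l _; rewrite mxE scalerDl.
Qed.

Lemma toral_ptZ x b : toral_pt (x *: b) = x *: toral_pt b.
Proof.
by rewrite scaler_sumr; apply: eq_bigr => l _; rewrite mxE scalerA.
Qed.

Lemma toral_pt0 : toral_pt 0 = 0.
Proof. by rewrite -(scale0r 0) toral_ptZ scale0r. Qed.

Lemma toral_pt_int y : toral_pt (map_mx intr y) = map_mx intr (tor y).
Proof.
apply/matrixP => i j; rewrite summxE !mxE rmorphMn rmorph_sum -sumrMnl /=.
apply: eq_bigr => l _.
by rewrite !mxE pairing_delta rmorphMn rmorphM /= mulrnAr mulrC.
Qed.

(** This is [lambda] with the scalar [c i] absorbed into the argument. *)
Definition root_subgroup i x : 'M[A]_m :=
  \sum_(r < m.+1) x ^+ r *: map_mx intr (dp (false, i) r).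

Lemma root_subgroup_widen i x N : (m <= N)%N ->
  root_subgroup i x = \sum_(r < N) x ^+ r *: map_mx intr (dp (false, i) r).
Proof.
move=> mN; pose F r := x ^+ r *: map_mx intr (dp (false, i) r) : 'M[A]_m.
have F0 r : (m <= r)%N -> F r = 0.
  by move=> mr; rewrite /F divided_power_big // map_mx0 scaler0.
have trunc K : (m <= K)%N -> \sum_(r < K) F r = \sum_(r < m) F r.
  move=> mK; rewrite -!(big_mkord xpredT F) (@big_cat_nat _ _ _ m) //=.
  rewrite [X in _ + X]big_nat_cond [X in _ + X]big1 ?addr0 // => r.
  by move=> /andP[/andP[/F0]].
by rewrite -/(\sum_(r < _) F r) [LHS]trunc ?trunc.
Qed.

(** The sum extends far enough to contain the terms of degree at most 2 even
    when [m] is zero. *)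
Lemma root_subgroup_conj i x (C : 'M[int]_m) :
  root_subgroup i x *m map_mx intr C *m root_subgroup i (- x) =
  \sum_(r < (m + m).+3) x ^+ r *: map_mx intr (ad_divided V (false, i) r C).
Proof.
set N := (m + m).+3.
have mN : (m <= N)%N by rewrite /N; lia.
rewrite !(root_subgroup_widen _ _ mN).
pose F p q : 'M[A]_m := (x ^+ (p + q)) *: map_mx intr
  ((-1) ^+ q *: (dp (false, i) p *m C *m dp (false, i) q)).
transitivity (\sum_(p < N) \sum_(q < N) F p q).
  rewrite !mulmx_suml; apply: eq_bigr => p _; rewrite mulmx_sumr.
  apply: eq_bigr => q _.
  rewrite /F map_mxZ !map_mxM -!scalemxAl -scalemxAr !scalerA.
  rewrite [(- x) ^+ _]exprNn rmorph_sign.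
  by rewrite exprD [(-1) ^+ q * _]mulrC mulrA.
rewrite sum_antidiagonal => [|p q pq].
  apply: eq_bigr => r _; rewrite /ad_divided raddf_sum scaler_sumr.
  by apply: eq_bigr => p _; rewrite /F subnKC // -ltnS.
have [mp|pm] := leqP m p.
  by rewrite /F divided_power_big // !mul0mx scaler0 map_mx0 scaler0.
rewrite /F (divided_power_big _ _ (r := q)) ?mulmx0 ?scaler0 ?map_mx0.
  by rewrite scaler0.
by move: pq pm; rewrite /N; lia.
Qed.

Lemma root_subgroupK i x : root_subgroup i x *m root_subgroup i (- x) = 1%:M.
Proof.
rewrite -[root_subgroup i x]mulmx1 -(map_mx1 intr) root_subgroup_conj.
rewrite big_ord_recl.
rewrite big1 => [|r _]; last by rewrite lift0 ad_divided_1 map_mx0 scaler0.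
by rewrite ad_divided0 expr0 scale1r map_mx1 addr0.
Qed.

Lemma root_subgroup_unit i x : root_subgroup i x \in unitmx.
Proof. by case/mulmx1_unit: (root_subgroupK i x). Qed.

Lemma invmx_root_subgroup i x :
  invmx (root_subgroup i x) = root_subgroup i (- x).
Proof.
rewrite -[LHS]mulmx1 -(root_subgroupK i x) mulmxA mulVmx ?mul1mx //.
exact: root_subgroup_unit.
Qed.

Lemma AdD (u C C' : 'M[A]_m) : Ad u (C + C') = Ad u C + Ad u C'.
Proof. by rewrite /Ad mulmxDr mulmxDl. Qed.

Lemma AdZ (u C : 'M[A]_m) x : Ad u (x *: C) = x *: Ad u C.
Proof. by rewrite /Ad -scalemxAr -scalemxAl. Qed.

Lemma Ad_sum (I : Type) (r : seq I) P u (F : I -> 'M[A]_m) :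
  Ad u (\sum_(i <- r | P i) F i) = \sum_(i <- r | P i) Ad u (F i).
Proof. by rewrite /Ad mulmx_sumr mulmx_suml. Qed.

Lemma Ad_mul (u v C : 'M[A]_m) : u \in unitmx -> v \in unitmx ->
  Ad (u *m v) C = Ad u (Ad v C).
Proof.
move=> uU vU; have uvU : u *m v \in unitmx by rewrite unitmx_mul uU.
rewrite /Ad; have -> : invmx (u *m v) = invmx v *m invmx u.
  apply: (can_inj (mulKmx uvU)).
  by rewrite mulmxV // mulmxA -(mulmxA u) mulmxV // mulmx1 mulmxV.
by rewrite !mulmxA.
Qed.

Lemma Ad_root_subgroup i x (C : 'M[int]_m) :
  Ad (root_subgroup i x) (map_mx intr C) =
  map_mx intr C +
  \sum_(r < (m + m).+2)
    x ^+ r.+1 *: map_mx intr (ad_divided V (false, i) r.+1 C).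
Proof.
rewrite /Ad invmx_root_subgroup root_subgroup_conj big_ord_recl.
by rewrite expr0 scale1r ad_divided0.
Qed.

Variable y0 : 'rV[int]_n.
Hypothesis y0_pos : forall i, 0 < pairing (al i) y0.
Local Notation ht x := (pairing x y0).

(** The part of [l + u] of height greater than [h].  Toral elements are left
    out, so that the toral component can be tracked separately. *)
Definition upper (h : int) (C : 'M[A]_m) : Prop :=
  exists2 a : bool * 'I_D -> A,
    (forall s, a s != 0 -> h < ht (rt s)) & C = \sum_s a s *: chev_pt s.

Lemma upper0 h : upper h 0.
Proof.
by exists (fun=> 0) => [s|]; rewrite ?eqxx // big1 // => s _; rewrite scale0r.
Qed.

Lemma upperD h C C' : upper h C -> upper h C' -> upper h (C + C').
Proof.
move=> [a ha ->] [b hb ->]; exists (fun s => a s + b s) => [s|].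
  by have [->|/ha //] := eqVneq (a s) 0; rewrite add0r => /hb.
by rewrite -big_split; apply: eq_bigr => s _; rewrite scalerDl.
Qed.

Lemma upperZ h x C : upper h C -> upper h (x *: C).
Proof.
move=> [a ha ->]; exists (fun s => x * a s) => [s|].
  by move=> nz; apply: ha; apply: contraNneq nz => ->; rewrite mulr0.
by rewrite scaler_sumr; apply: eq_bigr => s _; rewrite scalerA.
Qed.

Lemma upper_sum h (I : finType) (F : I -> 'M[A]_m) :
  (forall i, upper h (F i)) -> upper h (\sum_i F i).
Proof. by move=> hF; apply: big_ind => //; [apply: upper0|apply: upperD]. Qed.

Lemma upper_chev h s : h < ht (rt s) -> upper h (chev_pt s).
Proof.
move=> hs; exists (fun t => (t == s)%:R) => [t|].
  by case: (t =P s) => [-> //|]; rewrite eqxx.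
rewrite (bigD1 s) //= eqxx scale1r big1 ?addr0 // => t /negPf->.
by rewrite scale0r.
Qed.

Lemma upper_chev_int h s (a : int) : h < ht (rt s) ->
  upper h (map_mx intr (a *: chev V s)).
Proof. by move=> hs; rewrite map_mxZ; apply/upperZ/upper_chev. Qed.

Lemma upperW h h' C : h <= h' -> upper h' C -> upper h C.
Proof. by move=> hh [a ha ->]; exists a => // s /ha; apply: le_lt_trans. Qed.

(** The only weight-zero contribution to [Ad (exp (x e_i))] applied to a root
    vector comes from the opposite root vector: a multiple [r alpha_i] of a root
    that is itself a root has [r = 1]. *)
Lemma Ad_chev i x t : upper (ht (rt t))
  (Ad (root_subgroup i x) (chev_pt t) - chev_pt t -
   (x *+ (t == (true, i))) *: toral_pt (map_mx intr (cal i))).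
Proof.
rewrite /chev_pt Ad_root_subgroup [_ + \sum_(r < _) _]addrC addrK.
have [->|ti] := eqVneq t (true, i).
  rewrite big_ord_recl ad_divided_opp1 toral_pt_int expr1 addrC addKr.
  rewrite big_ord_recl big1 => [|r _]; last first.
    by rewrite !lift0 ad_divided_opp3 map_mx0 scaler0.
  rewrite addr0 ad_divided_opp2 -scaleN1r; apply/upperZ/upper_chev_int.
  rewrite /Defs.root /signed /= pairingNl (lt_trans _ (y0_pos i)) //.
  by rewrite oppr_lt0.
rewrite scale0r subr0; apply: upper_sum => r; apply: upperZ.
have [|->|[u [a [ru ->]]]] := @ad_divided_chev _ _ _ _ V (false, i) t r.+1.
- by move=> e; case/eqP: ti.
- by rewrite map_mx0; apply: upper0.
apply: upper_chev_int; rewrite ru pairingDl pairingZl ltrDl mulr_gt0 //.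
exact: y0_pos.
Qed.

Lemma Ad_upper i x h a : (forall s, a s != 0 -> h < ht (rt s)) ->
  upper h (Ad (root_subgroup i x) (\sum_s a s *: chev_pt s) -
           (x * a (true, i)) *: toral_pt (map_mx intr (cal i))).
Proof.
move=> ha; rewrite Ad_sum.
rewrite (bigD1 (true, i)) //= addrAC; apply: upperD.
  have [->|nz] := eqVneq (a (true, i)) 0.
    by rewrite AdZ scale0r mulr0 scale0r subr0; apply: upper0.
  rewrite AdZ mulrC -scalerA -scalerBr; apply: upperZ.
  have := Ad_chev i x (true, i); rewrite eqxx mulr1n.
  move=> /(upperW (ltW (ha _ nz)))/upperD /(_ (upper_chev (ha _ nz))).
  by rewrite addrAC subrK.
apply: big_ind => [||s si]; [exact: upper0 | exact: upperD |].
have [->|nz] := eqVneq (a s) 0; first by rewrite AdZ scale0r; apply: upper0.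
rewrite AdZ; apply: upperZ.
have := Ad_chev i x s; rewrite (negPf si) mulr0n scale0r subr0.
move=> /(upperW (ltW (ha _ nz)))/upperD /(_ (upper_chev (ha _ nz))).
by rewrite subrK.
Qed.

Lemma Ad_toral i x b h : h <= 0 ->
  upper h (Ad (root_subgroup i x) (toral_pt b) - toral_pt b).
Proof.
move=> h0; rewrite Ad_sum -sumrB; apply: upper_sum => l.
rewrite AdZ -scalerBr Ad_root_subgroup addrC addKr; apply/upperZ.
rewrite big_ord_recl big1 => [|r _]; last first.
  by rewrite lift0 ad_divided_toral2 map_mx0 scaler0.
rewrite addr0 ad_divided_toral1; apply/upperZ/upper_chev_int.
exact: le_lt_trans h0 (y0_pos i).
Qed.

(** Each factor contributes one multiple of one coroot to the toral part, whose
    coefficient is the coordinate at [- alpha_j] reached so far; as the height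
    has increased, it vanishes unless [alpha_j] is lower than [alpha_l] or [j]
    is [l]. *)
Lemma Ad_prod_root_subgroup (x : 'I_D -> A) l (js : seq 'I_D) : uniq js ->
  exists2 T : 'I_D -> A,
    T l = 1 /\ (forall j, j != l -> T j != 0 -> ht (al j) < ht (al l)) &
    exists2 w, upper (ht (rt (true, l))) w &
    Ad (\prod_(j <- js) root_subgroup j (x j) : 'M[A]_m) (chev_pt (true, l)) =
    chev_pt (true, l) +
    toral_pt (\sum_(j <- js) (T j * x j) *: map_mx intr (cal j)) + w.
Proof.
have htN j : ht (rt (true, j)) = - ht (al j).
  by rewrite /Defs.root /signed /= pairingNl.
elim: js => [_|i js IH /= /andP[ijs /IH{IH}[T [Tl Tlow] [w uw wE]]]].
  exists (fun j => (j == l)%:R).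
    by split=> [|j /negPf->]; rewrite !eqxx.
  exists 0; first exact: upper0.
  rewrite !big_nil toral_pt0 !addr0 /Ad -[1]/(1%:M) mul1mx.
  by rewrite invmx1 mulmx1.
have [a ha wa] := uw.
pose T' j := if j == i then (i == l)%:R + a (true, i) else T j.
exists T'.
  rewrite /T'; split=> [|j jl].
    have [<-|//] := eqVneq l i.
    have [->|/ha] := eqVneq (a (true, l)) 0; first by rewrite addr0.
    by rewrite ltxx.
  have [ji|_] := eqVneq j i; last exact: Tlow.
  by rewrite -ji (negPf jl) add0r => /ha; rewrite !htN ltrN2.
set B := \sum_(j <- js) _ in wE.
pose H := toral_pt (map_mx intr (cal i)).
pose u := root_subgroup i (x i).
(* one error term for each of the three summands of the previous value *)
exists ((Ad u w - (x i * a (true, i)) *: H) +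
        (Ad u (toral_pt B) - toral_pt B) +
        (Ad u (chev_pt (true, l)) - chev_pt (true, l) -
         (x i *+ ((true, l) == (true, i))) *: H)).
  apply: upperD; last exact: Ad_chev.
  apply: upperD; first by rewrite wa; apply: Ad_upper.
  by apply: Ad_toral; rewrite htN oppr_le0 ltW.
have prodU (s : seq 'I_D) :
    (\prod_(j <- s) root_subgroup j (x j) : 'M[A]_m) \in unitmx.
  apply: (big_ind (fun u : 'M[A]_m => u \in unitmx)) => [|v v' vU v'U|j _].
  - exact: unitmx1.
  - by rewrite -mulmxE unitmx_mul vU.
  - exact: root_subgroup_unit.
rewrite !big_cons -mulmxE Ad_mul ?root_subgroup_unit // wE !AdD.
have -> : \sum_(j <- js) (T' j * x j) *: map_mx intr (cal j) = B.
  rewrite /B !big_seq; apply: eq_bigr => j js_j; rewrite /T'.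
  by case: (j =P i) js_j => [->|//]; rewrite (negPf ijs).
rewrite toral_ptD toral_ptZ /T' eqxx xpair_eqE eqxx /= [l == i]eq_sym.
rewrite mulrDl mulr_natl [a _ * _]mulrC scalerDl.
rewrite -/H -/u.
move: (Ad u w) (Ad u (toral_pt B)) (Ad u (chev_pt _)) => c1 c2 c3.
apply/matrixP => p q; rewrite !mxE; ring.
Qed.

End Points.

(** * The matrix of phi *)

Section PhiMatrix.

Variables (n D : nat) (Phi : sc_root_datum n D) (m : nat).
Variables (V : sc_chevalley_rep Phi m) (k : fieldType).
Variable c : 'I_D -> k.
Hypothesis c_neq0 : forall i, c i != 0.
Local Notation rt := (Defs.root Phi).
Local Notation al := (proot Phi).
Local Notation cal := (pcoroot Phi).
Local Notation tor := (toral (wt V)).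

(** The weights generate the character lattice, so a toral element is
    determined by its diagonal entries over any field. *)
Lemma h_mx_free : row_free (h_mx V k).
Proof.
apply: inj_row_free => v vh.
have diag0 i : \sum_l v 0 l * (wt V i 0 l)%:~R = 0.
  have /matrixP/(_ i i) := congr1 vec_mx vh.
  rewrite mulmx_sum_row linear_sum summxE linear0 !mxE => e.
  rewrite -[RHS]e; apply: eq_bigr => l _.
  by rewrite rowK linearZ /= mxvecK !mxE eqxx mulr1n pairing_delta.
apply/rowP => j; rewrite mxE.
have [d dE] := wt_span V (delta_mx 0 j).
transitivity (\sum_i (d i)%:~R * (\sum_l v 0 l * (wt V i 0 l)%:~R)); last first.
  by rewrite big1 // => i _; rewrite diag0 mulr0.
under eq_bigr do rewrite mulr_sumr.
rewrite exchange_big /=.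
transitivity (\sum_l v 0 l * ((delta_mx 0 j : 'rV[int]_n) 0 l)%:~R).
  rewrite (bigD1 j) //= mxE !eqxx mulr1 big1 ?addr0 // => l /negPf lj.
  by rewrite mxE eqxx lj mulr0.
apply: eq_bigr => l _; rewrite dE summxE rmorph_sum mulr_sumr.
by apply: eq_bigr => i _; rewrite mxE rmorphM /= mulrCA.
Qed.

Lemma chev_diag0 s j : chev V s j j = 0.
Proof.
apply/eqP; apply: contraT => /chev_graded; rewrite subrr => /esym e.
by case: (@root_neq0 _ _ Phi s).
Qed.

(** Toral matrices are diagonal and root vectors have zero diagonal, so the
    triangular decomposition is direct in every characteristic. *)
Lemma h_lu_direct : (<<h_mx V k>> :&: (l_mx V c + u_mx V c) = 0)%MS.
Proof.
apply/eqP/rowV0P => v; rewrite sub_capmx genmxE => /andP[/submxP[a va]].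
move=> /sub_addsmxP[[b d] vbd].
apply: (can_inj (@vec_mxK _ _ _)); rewrite linear0; apply/matrixP => i j.
rewrite [RHS]mxE; have [<-|ij] := eqVneq i j.
  rewrite vbd !mulmx_sum_row linearD !linear_sum mxE !summxE !big1 ?addr0 //.
    by move=> s _; rewrite rowK linearZ /= mxvecK !mxE chev_diag0 !mulr0.
  by move=> s _; rewrite rowK linearZ /= mxvecK !mxE chev_diag0 !mulr0.
rewrite va mulmx_sum_row linear_sum summxE big1 // => l _.
by rewrite rowK linearZ /= mxvecK !mxE (negPf ij) mulr0n mulr0.
Qed.

Variable A : comUnitAlgType k.

Lemma map_in_alg_int p q (M : 'M[int]_(p, q)) :
  map_mx (GRing.in_alg A) (map_mx intr M) = map_mx intr M.
Proof. by apply/matrixP => i j; rewrite !mxE /= scaler_int. Qed.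

Local Notation proj := (proj_mx <<h_mx V k>>%MS (l_mx V c + u_mx V c)%MS).

Lemma proj_chev s : mxvec (chev_pt V A s) *m map_mx (GRing.in_alg A) proj = 0.
Proof.
have chevE : chev_pt V A s = map_mx (GRing.in_alg A) (map_mx intr (chev V s)).
  by rewrite map_in_alg_int.
rewrite chevE -map_mxvec -map_mxM proj_mx_0 ?map_mx0 ?h_lu_direct //.
case: s {chevE} => [[] i].
  apply: submx_trans (addsmxSl _ _).
  have := row_sub i (l_mx V c); rewrite rowK /Y_vec linearZ /=.
  by rewrite eqmx_scale // invr_eq0.
apply: submx_trans (addsmxSr _ _).
have := row_sub i (u_mx V c); rewrite rowK /X_vec linearZ /=.
by rewrite eqmx_scale.
Qed.

Lemma mxvec_toral_pt (b : 'rV[A]_n) :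
  mxvec (toral_pt V b) = b *m map_mx (GRing.in_alg A) (h_mx V k).
Proof.
rewrite mulmx_sum_row linear_sum; apply: eq_bigr => l _.
by rewrite linearZ /= -map_row rowK map_mxvec map_in_alg_int.
Qed.

Lemma h_coord_proj y0 h (b : 'rV[A]_n) w : upper V y0 h w ->
  h_coord V (proj_h V c (toral_pt V b + w)) = b.
Proof.
move=> [a _ ->]; rewrite /h_coord /proj_h vec_mxK linearD mulmxDl /=.
rewrite [X in _ + X](_ : _ = 0) ?addr0; last first.
  rewrite linear_sum mulmx_suml big1 // => s _.
  by rewrite linearZ /= -scalemxAl proj_chev scaler0.
rewrite mxvec_toral_pt -(mulmxA b) -map_mxM proj_mx_id ?h_lu_direct ?genmxE //.
by rewrite -mulmxA -map_mxM mulmxVp ?h_mx_free // map_mx1 mulmx1.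
Qed.

(** The projection to [h] reads off the toral part of [Ad_u Y_l], which has been
    computed factor by factor; the coefficients [T] form row [l] of the
    unitriangular factor in [M = T diag(x) C].  The scalars [c] of the chosen
    root vectors cancel on the diagonal of that factor. *)
Lemma phi_mx_row y0 (x : 'I_D -> A) l :
  (forall i, 0 < pairing (al i) y0) ->
  exists2 T : 'I_D -> A, T l = 1 /\
    (forall j, j != l -> T j != 0 -> pairing (al j) y0 < pairing (al l) y0) &
  row l (phi_mx V c (Psi V c x)) =
    \sum_j (T j * x j) *: map_mx intr (cal j).
Proof.
move=> y0_pos.
have [T [Tl Tlow] [w uw wE]] :=
  Ad_prod_root_subgroup V y0_pos (fun j => c j *: x j) l (index_enum_uniq 'I_D).
exists (fun j => ((c l)^-1 * c j) *: T j).
  split=> [|j jl nz]; first by rewrite Tl mulVf // scale1r.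
  by apply: Tlow => //; apply: contraNneq nz => ->; rewrite scaler0.
rewrite rowK /phi.
have YE : map_mx (GRing.in_alg A) (Y_vec V c l) =
    (c l)^-1%:A *: chev_pt V A (true, l).
  by rewrite /Y_vec map_mxZ map_in_alg_int.
rewrite YE AdZ /Psi wE addrAC [_ + toral_pt _ _]addrC scalerDr -toral_ptZ.
set h := pairing (Defs.root Phi (true, l)) y0 in uw.
rewrite (@h_coord_proj y0 (h - 1)); last first.
  apply/upperZ/upperD; last by apply: upperW uw; rewrite gerBl.
  by apply: upper_chev; rewrite ltrBlDr ltrDl.
rewrite scaler_sumr; apply: eq_bigr => j _; rewrite scalerA; congr (_ *: _).
by rewrite -scalerAr -!scalerAl mul1r scalerA.
Qed.

End PhiMatrix.

(** * Minors and the inclusion of ideals *)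

Section IdealGen.

Variables (A : comPzRingType) (G : A -> Prop).

Lemma ideal_genD a b : ideal_gen G a -> ideal_gen G b -> ideal_gen G (a + b).
Proof.
move=> [s sG ->] [t tG ->]; exists (s ++ t); last by rewrite big_cat.
by move=> x; rewrite mem_cat => /orP[/sG|/tG].
Qed.

Lemma ideal_genM a b : ideal_gen G b -> ideal_gen G (a * b).
Proof.
move=> [s sG ->]; exists [seq (a * x.1, x.2) | x <- s].
  by move=> _ /mapP[x /sG xG ->].
by rewrite big_map mulr_sumr; apply: eq_bigr => x _; rewrite mulrA.
Qed.

Lemma ideal_gen_sum (I : eqType) (r : seq I) (P : pred I) (F : I -> A) :
  (forall i, i \in r -> P i -> ideal_gen G (F i)) ->
  ideal_gen G (\sum_(i <- r | P i) F i).
Proof.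
move=> FG; rewrite big_seq_cond; apply: big_ind.
- by exists [::]; rewrite ?big_nil.
- exact: ideal_genD.
- by move=> i /andP[/FG]; apply.
Qed.

Lemma ideal_gen_generator a : G a -> ideal_gen G a.
Proof.
move=> Ga; exists [:: (1, a)]; last by rewrite big_seq1 mul1r.
by move=> x; rewrite inE => /eqP->.
Qed.

End IdealGen.

(** Multilinear expansion of a determinant along the rows of a product; a weak
    form of the Cauchy-Binet formula. *)
Lemma det_mulmx_minors (A : comPzRingType) n D (Q : 'M[A]_(n, D))
    (M : 'M[A]_(D, n)) :
  \det (Q *m M) = \sum_(f : {ffun 'I_n -> 'I_D} | injectiveb f)
    (\prod_i Q i (f i)) * \det (rowsub f M).
Proof.
transitivity (\sum_(f : {ffun 'I_n -> 'I_D})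
    (\prod_i Q i (f i)) * \det (rowsub f M)).
  pose F (s : 'S_n) i j := Q i j * M j (s i).
  transitivity (\sum_(s : 'S_n) \sum_(f : {ffun 'I_n -> 'I_D})
      (-1) ^+ s * \prod_i F s i (f i)).
    apply: eq_bigr => s _; rewrite -big_distrr -(bigA_distr_bigA (F s)) /=.
    by congr (_ * _); apply: eq_bigr => i _; rewrite mxE.
  rewrite exchange_big; apply: eq_bigr => f _; rewrite big_distrr /=.
  apply: eq_bigr => s _; rewrite big_split mulrCA; congr (_ * (_ * _)).
  by apply: eq_bigr => i _; rewrite mxE.
rewrite (bigID (fun f : {ffun 'I_n -> 'I_D} => injectiveb f)) /=.
rewrite [X in _ + X]big1 ?addr0 // => f /injectivePn[i [j ij fij]].
by rewrite (determinant_alternate ij) ?mulr0 // => l; rewrite !mxE fij.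
Qed.

Section Inclusion.

Variables (k : fieldType) (n D m : nat) (Phi : sc_root_datum n D).
Variables (V : sc_chevalley_rep Phi m) (c : 'I_D -> k).
Hypothesis c_neq0 : forall i, c i != 0.
Local Notation al := (proot Phi).
Local Notation cal := (pcoroot Phi).

(** Inverting the unitriangular factor, by induction on the height. *)
Lemma coroot_row_span (A : comUnitAlgType k) (x : 'I_D -> A) l :
  exists q : 'rV[A]_D,
    x l *: map_mx intr (cal l) = q *m phi_mx V c (Psi V c x).
Proof.
have [y0 y0_pos] := root_positive Phi.
set M := phi_mx V c _.
have [N] := ubnP `|pairing (al l) y0|; elim: N l => // N IH l lN.
have [T [Tl Tlow] rowMl] := phi_mx_row V c_neq0 x l y0_pos.
have: exists q : 'rV[A]_D,
    \sum_(j | j != l) (T j * x j) *: map_mx intr (cal j) = q *m M.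
  apply: (big_ind (fun v => exists q : 'rV[A]_D, v = q *m M)).
  - by exists 0; rewrite mul0mx.
  - by move=> u v [q ->] [q' ->]; exists (q + q'); rewrite mulmxDl.
  move=> j jl; have [->|Tj] := eqVneq (T j) 0.
    by exists 0; rewrite mul0r scale0r mul0mx.
  have [|q qE] := IH j.
    rewrite ltnS in lN; apply: leq_trans lN.
    by rewrite -ltz_nat !gtz0_abs ?y0_pos // Tlow.
  by exists (T j *: q); rewrite -scalerA qE scalemxAl.
case=> q qE; exists (delta_mx 0 l - q).
by rewrite mulmxBl -rowE -qE rowMl (bigD1 l) //= Tl mul1r addrK.
Qed.

Lemma basis_monomial_ideal_B (f : 'I_n -> 'I_D) :
  good_characteristic Phi k -> independent_roots Phi f ->
  ideal_B V c (\prod_i ('X_(f i) : {mpoly k[D]})).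
Proof.
move=> good indep; set x := fun i => 'X_i : {mpoly k[D]}.
pose C : 'M[k]_n := \matrix_(i < n) map_mx intr (cal (f i)).
have detC : \det C != 0 by apply: det_coroots_neq0.
have /fin_all_exists[q qE] i := coroot_row_span x (f i).
pose Q : 'M[{mpoly k[D]}]_(n, D) := \matrix_i q i.
have QM : Q *m phi_mx V c (Psi V c x) =
    diag_mx (\row_i x (f i)) *m map_mx (GRing.in_alg {mpoly k[D]}) C.
  apply/row_matrixP => i; rewrite row_mul rowK -qE row_mul row_diag_mx mxE.
  rewrite -scalemxAl -rowE -map_row rowK; congr (_ *: _).
  by apply/rowP => j; rewrite !mxE /= scaler_int.
have := congr1 determinant QM.
rewrite det_mulmx_minors det_mulmx det_diag det_map_mx /= => e.
have -> : \prod_i x (f i) = ((\det C)^-1)%:A *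
    (\prod_i (\row_i x (f i)) 0 i * (\det C)%:A).
  rewrite mulrCA -scalerAl mul1r scalerA mulVf // scale1r mulr1.
  by apply: eq_bigr => i _; rewrite mxE.
rewrite -e; apply/ideal_genM/ideal_gen_sum => g _ /injectiveP g_inj.
by apply/ideal_genM/ideal_gen_generator; exists g.
Qed.

End Inclusion.

Theorem theorem4p1 (R : realType) (k : fieldType) (n D m : nat)
    (Phi : sc_root_datum n D) (V : sc_chevalley_rep Phi m)
    (c : 'I_D -> k) (c_neq0 : forall i, c i != 0)
    (k_good : good_characteristic Phi k) (f : {mpoly k[D]}) :
  stanley_reisner_ideal Phi R f -> ideal_B V c f.
Proof.
move=> [s sG ->]; apply: ideal_gen_sum => x /sG[S nonface ->] _.
apply: ideal_genM.
have [g [g_inj gS indep]] := nonface_basis nonface.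
rewrite (bigID (mem (codom g))) /= mulrC; apply: ideal_genM.
have -> : \prod_(i in S | i \in codom g) ('X_i : {mpoly k[D]}) =
    \prod_i 'X_(g i).
  transitivity (\prod_(i in [set g i | i : 'I_n]) ('X_i : {mpoly k[D]})).
    apply: eq_bigl => i; apply/andP/imsetP => [[_ /codomP[j ->]]|[j _ ->]].
      by exists j.
    by rewrite gS codom_f.
  by rewrite big_imset //= => i j _ _; apply: g_inj.
exact: basis_monomial_ideal_B.
Qed.
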